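(* If $\mathcal{I}$ is a coanalytic weak P-ideal on $\omega$, then $$\aleph_1\le\mathfrak{b}(\mathcal{I},\mathcal{I},\mathcal{I})\le\mathfrak{b}=\mathfrak{b}(\mathcal{I},\mathrm{Fin},\mathrm{Fin})=\mathfrak{b}(\mathcal{I},\mathcal{I},\mathrm{Fin}).$$
   Context: An ideal on $\omega$ is a family $\mathcal{I}\subseteq\mathcal{P}(\omega)$ closed under finite unions and subsets, containing all finite sets, with $\omega\notin\mathcal{I}$; $\mathrm{Fin}$ is the ideal of finite sets. $\mathcal{P}(\omega)$ is identified with the Cantor space $\{0,1\}^\omega$; an ideal is coanalytic if it is a coanalytic subset of this space. $\mathcal{I}$ is a weak P-ideal if for every countable $\mathcal{A}\subseteq\mathcal{I}$ there is $B\notin\mathcal{I}$ with $A\cap B$ finite for every $A\in\mathcal{A}$. $\mathfrak{b}$ is the bounding number. For an ideal $\mathcal{K}$, $\widehat{\mathcal{P}}_{\mathcal{K}}$ is the family of sequences $\langle A_n\rangle$ of pairwise disjoint members of $\mathcal{K}$, and $\mathcal{P}_{\mathcal{K}}$ those with union $\omega$. $\mathfrak{b}(\mathcal{I},\mathcal{J},\mathcal{K})=\min\{|\mathcal{E}|:\mathcal{E}\subseteq\widehat{\mathcal{P}}_{\mathcal{K}},\ \forall\langle A_n\rangle\in\mathcal{P}_{\mathcal{J}}\ \exists\langle E_n\rangle\in\mathcal{E}\ \bigcup_n(A_n\cap\bigcup_{i\le n}E_i)\notin\mathcal{I}\}$, with $\min\emptyset=\mathfrak{c}^+$. *)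

(* Defs.v *)
From HB Require Import structures.
From mathcomp Require Import all_boot all_order.
From mathcomp Require Import all_classical topology cantor.

Set Implicit Arguments.
Unset Strict Implicit.
Unset Printing Implicit Defensive.

Local Open Scope classical_set_scope.
Local Open Scope card_scope.

(* A cardinal is an equipotence class of types (in a fixed universe), so that
   Leibniz equality of cardinals is equality of cardinalities: see
   [cardinal_ofE] and [lecE]. *)
Record cardinal := Cardinal {
  cardinal_class :> Type -> Prop;
  _ : exists A : Type, cardinal_class = fun B : Type => [set: A] #= [set: B]
}.

Lemma cardinal_of_subproof (T : Type) (A : set T) : exists A' : Type,
  (fun B : Type => A #= [set: B] : Prop) = fun B : Type => [set: A'] #= [set: B].
Proof.
exists (set_type A); apply: funext => B; congr is_true.
by apply: card_eql; rewrite card_eq_sym card_setT.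
Qed.

Definition cardinal_of (T : Type) (A : set T) : cardinal :=
  Cardinal (cardinal_of_subproof A).

Definition lec (c d : cardinal) : Prop :=
  exists A B : Type, [/\ c A, d B & [set: A] #<= [set: B]].

Definition ltc (c d : cardinal) : Prop := lec c d /\ c <> d.

(* [d] is the conventional value of the minimum of the empty class; a nonempty
   class of cardinals always has a minimum, see [minc_in] and [minc_le]. *)
Definition minc (d : cardinal) (S : cardinal -> Prop) : cardinal :=
  if pselect (exists c, S c /\ forall c', S c' -> lec c c') is left ex
  then sval (cid ex) else d.

Definition aleph0 : cardinal := cardinal_of [set: nat].

Definition succc (c : cardinal) : cardinal := minc c (ltc c).

Definition aleph1 : cardinal := succc aleph0.

Definition continuum : cardinal := cardinal_of [set: set nat].

Lemma cardinal_eqP (c d : cardinal) :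
  (c : Type -> Prop) = (d : Type -> Prop) -> c = d.
Proof.
case: c d => [c Hc] [d Hd] /= e; move: Hc Hd; rewrite e => Hc Hd.
by congr Cardinal; exact: Prop_irrelevance.
Qed.

Lemma cardinal_surj (c : cardinal) : exists A : Type, c = cardinal_of [set: A].
Proof. by case: (c) => f [A fA]; exists A; apply: cardinal_eqP. Qed.

Lemma cardinal_ofE (T U : Type) (A : set T) (B : set U) :
  cardinal_of A = cardinal_of B <-> A #= B.
Proof.
split=> [AB|AB].
  have : cardinal_of A (set_type B).
    by rewrite AB /= card_eq_sym card_setT.
  by move=> /= /card_eq_trans; apply; rewrite card_setT.
by apply: cardinal_eqP => /=; apply: funext => C; congr is_true; apply: card_eql.
Qed.

Lemma lecE (T U : Type) (A : set T) (B : set U) :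
  lec (cardinal_of A) (cardinal_of B) <-> A #<= B.
Proof.
split=> [[A' [B' /= [AA BB AB]]]|AB].
  by rewrite (card_le_eql AA) (card_le_eqr BB).
exists (set_type A), (set_type B); split => /=.
- by rewrite card_eq_sym card_setT.
- by rewrite card_eq_sym card_setT.
- by rewrite (card_le_eql (card_setT A)) (card_le_eqr (card_setT B)).
Qed.

Lemma exists_min_card (T : Type) (F : set (set T)) : F !=set0 ->
  exists2 A, F A & forall B, F B -> A #<= B.
Proof.
move=> [B0 FB0].
have [[A FA A0]|nF0] := pselect (exists2 A, F A & A = set0).
  by exists A => // B _; rewrite A0 card_ge0.
pose P (M : set (set T -> T)) :=
  (forall g B, M g -> F B -> B (g B)) /\
  (forall g h B, M g -> M h -> F B -> g B = h B -> g = h).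
have [|M [[Min Minj] Mmax]] := @Zorn_bigcup _ P.
  move=> G GP Gtot; split.
    by move=> g B [M GM Mg] FB; have [/(_ g B Mg FB)] := GP _ GM.
  move=> g h B [M GM Mg] [N GN Nh] FB.
  have [MN|NM] := Gtot _ _ GM GN.
    by have [_] := GP _ GN; apply=> //; exact: MN.
  by have [_] := GP _ GM; apply=> //; exact: NM.
have [A [FA AM]] : exists A, F A /\ forall a, A a -> exists2 g, M g & g A = a.
  apply: contrapT => /forallNP noA.
  have /choice[h hP] : forall A, exists a, F A -> A a /\ forall g, M g -> g A <> a.
    move=> A; have [FA|nFA] := pselect (F A); last first.
      have [B0e|/eqP/set0P[x _]] := pselect (B0 = set0).
        by case: nF0; exists B0.
      by exists x.
    have /not_andP[//|/existsNP[a /not_implyP[Aa aM]]] := noA A.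
    by exists a => _; split=> // g Mg ga; apply: aM; exists g.
  apply: (Mmax (M `|` [set h])).
    split; first by move=> ?; left.
    by move=> /(_ h (or_intror erefl)) Mh; have [_ /(_ _ Mh)] := hP _ FB0.
  split.
    by move=> g B [Mg|->] FB; [exact: (Min g)|have [] := hP _ FB].
  move=> g k B [Mg|->] [Mk|->] FB //; first exact: Minj.
    by move=> e; have [_ /(_ _ Mg)] := hP _ FB.
  by move=> e; have [_ /(_ _ Mk)] := hP _ FB; rewrite e.
exists A => // B FB; apply: (@card_le_trans _ _ _ M).
  have /subset_card_le : A `<=` (fun g => g A) @` M.
    by move=> a /AM[g Mg ga]; exists g.
  by move=> /card_le_trans; apply; exact: card_image_le.
have -> : (M #<= B) = ((fun g => g B) @` M #<= B).
  apply/esym/card_le_eql/inj_card_eq => g h /set_mem Mg /set_mem Mh.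
  exact: Minj.
by apply: subset_card_le => _ [g Mg <-]; exact: (Min g).
Qed.

Lemma lec_total (c d : cardinal) : lec c d \/ lec d c.
Proof.
have [A ->] := cardinal_surj c; have [B ->] := cardinal_surj d.
rewrite !lecE.
have iA : (@inl A B) @` setT #= [set: A] by apply: inj_card_eq => ? ? _ _ [].
have iB : (@inr A B) @` setT #= [set: B] by apply: inj_card_eq => ? ? _ _ [].
have [|X [->|->] XP] :=
    @exists_min_card _ [set (@inl A B) @` setT; (@inr A B) @` setT].
- by exists (inl @` setT); left.
- by left; rewrite -(card_le_eql iA) -(card_le_eqr iB); apply: XP; right.
- by right; rewrite -(card_le_eqr iA) -(card_le_eql iB); apply: XP; left.
Qed.

Lemma exists_minc (S : cardinal -> Prop) : (exists c, S c) ->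
  exists c, S c /\ forall c', S c' -> lec c c'.
Proof.
move=> [c Sc]; have [T cT] := cardinal_surj c; rewrite {}cT in Sc.
have [|A SA Amin] := @exists_min_card T [set X | S (cardinal_of X)].
  by exists setT.
exists (cardinal_of A); split=> // d Sd.
have [D dD] := cardinal_surj d; rewrite {}dD in Sd *.
apply/lecE; have [/lecE TD|/lecE DT] :=
  lec_total (cardinal_of [set: T]) (cardinal_of [set: D]).
  exact: card_le_trans (card_leT A) TD.
move/card_leP: DT => /unsquash f.
pose g (x : D) : T := val (f (SigSub (mem_set (I : [set: D] x)))).
have fD : g @` setT #= [set: D].
  apply: inj_card_eq => x y _ _ /val_inj/(@inj _ _ _ f).
  by rewrite !inE => /(_ I I) [].
rewrite -(card_le_eqr fD); apply: Amin => /=.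
by have /cardinal_ofE -> := fD.
Qed.

Lemma minc_in (d : cardinal) (S : cardinal -> Prop) :
  (exists c, S c) -> S (minc d S).
Proof.
rewrite /minc => /exists_minc ex; case: pselect => // ex'.
by case: cid => c [].
Qed.

Lemma minc_le (d : cardinal) (S : cardinal -> Prop) (c : cardinal) :
  S c -> lec (minc d S) c.
Proof.
rewrite /minc => Sc; case: pselect => [ex|[]]; last first.
  by apply: exists_minc; exists c.
by case: cid => m /= [_]; apply.
Qed.

Lemma minc0 (d : cardinal) (S : cardinal -> Prop) :
  ~ (exists c, S c) -> minc d S = d.
Proof.
rewrite /minc => noS; case: pselect => [ex|//].
by case: noS; have [c [Sc _]] := ex; exists c.
Qed.

Lemma ltc_powerset (T : Type) :
  ltc (cardinal_of [set: T]) (cardinal_of [set: set T]).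
Proof.
split.
  apply/lecE; have /card_eqPle[] : (@set1 T) @` setT #= [set: T].
    apply: inj_card_eq => x y _ _ /seteqP[xy _].
    by have := xy x erefl.
  by move=> _ /card_le_trans; apply; exact: card_leT.
move=> /cardinal_ofE /card_eqPle[_].
move=> /card_leP/unsquash f.
pose g (X : set T) : T := val (f (SigSub (mem_set (I : [set: set T] X)))).
have gI : injective g.
  move=> X Y /val_inj/(@inj _ _ _ f).
  by rewrite !inE => /(_ I I) [].
pose D := [set x | exists2 X, g X = x & ~ X x].
have nD : ~ D (g D) by move=> [X /gI -> ] nX; apply: (nX); exists D.
by apply: (nD); exists D.
Qed.

Lemma ltc_succc (c : cardinal) : ltc c (succc c).
Proof.
apply: minc_in; have [T ->] := cardinal_surj c.
by exists (cardinal_of [set: set T]); exact: ltc_powerset.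
Qed.

Definition eventually_le (f g : nat -> nat) : Prop :=
  \forall n \near \oo, (f n <= g n)%N.

Definition unbounded_family (F : set (nat -> nat)) : Prop :=
  ~ exists g, forall f, F f -> eventually_le f g.

Definition bounding_number : cardinal :=
  minc (succc continuum)
    (fun c => exists2 F, unbounded_family F & c = cardinal_of F).

Definition baire_space : Type := prod_topology (fun _ : nat => nat).

HB.instance Definition _ := Topological.on baire_space.

Definition analytic (X : topologicalType) (S : set X) : Prop :=
  S = set0 \/ exists2 f : baire_space -> X, continuous f & S = range f.

Definition coanalytic (X : topologicalType) (S : set X) : Prop :=
  analytic (~` S).

(* The copy of a family of subsets of omega in the Cantor space, under the
   identification of a subset with its characteristic function. *)
Definition cantor_family (I : set (set nat)) : set cantor_space :=
  [set x | I [set n | x n]].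

Definition ideal (I : set (set nat)) : Prop :=
  [/\ forall A B, I A -> I B -> I (A `|` B),
      forall A B, A `<=` B -> I B -> I A,
      forall A, finite_set A -> I A
    & ~ I setT].

Definition Fin : set (set nat) := [set A | finite_set A].

Definition weak_P_ideal (I : set (set nat)) : Prop :=
  forall F : set (set nat), countable F -> F `<=` I ->
    exists2 B, ~ I B & forall A, F A -> finite_set (A `&` B).

Definition disjoint_seqs (K : set (set nat)) : set (nat -> set nat) :=
  [set A | (forall n, K (A n)) /\ trivIset setT A].

Definition partitions (K : set (set nat)) : set (nat -> set nat) :=
  [set A | disjoint_seqs K A /\ \bigcup_n A n = setT].

Definition b_family (I J K : set (set nat)) (F : set (nat -> set nat)) : Prop :=
  F `<=` disjoint_seqs K /\
  forall A, partitions J A -> exists2 E, F E &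
    ~ I (\bigcup_n (A n `&` \bigcup_(i in [set i | (i <= n)%N]) E i)).

Definition b_cardinal (I J K : set (set nat)) : cardinal :=
  minc (succc continuum)
    (fun c => exists2 F, b_family I J K F & c = cardinal_of F).

(* Main.v *)
(** The inequalities b <= b(I,Fin,Fin) <= b(I,I,Fin) and aleph1 <= b(I,I,I) hold
for every ideal; the work is in b(I,I,Fin) <= b. Let F be an unbounded family and
attach to f in F the disjoint sequence E with E_0, ..., E_n covering exactly
[0, max_(i <= n) f i). Given a partition A into sets of I, the weak P-property
yields B not in I with all A_n `&` B finite, and
J = {M | the union of the A_n `&` B, n in M, is in I} is again a proper coanalytic
ideal. Such a J is meager: by Nikodym's argument a Suslin set that is nonmeager in
every cylinder is comeager, while if the J-positive sets are meager in some
cylinder, then tail-invariance and complementation make J meager. By the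
Talagrand / Jalali-Naini argument there are intervals [n, n + l n) such that no
set containing infinitely many of them is in J. Some f in F exceeds, for
infinitely many n, all elements of A_m `&` B with m < n + l n, so that the set of
m with A_m `&` B covered by E_0, ..., E_m is J-positive. *)

Require Import Defs.
From mathcomp Require Import all_boot all_order.
From mathcomp Require Import all_classical topology sequences cantor.
From mathcomp Require Import zify.

Set Implicit Arguments.
Unset Strict Implicit.
Unset Printing Implicit Defensive.

Local Open Scope classical_set_scope.

(** * Meager sets in the Cantor space *)

Definition matches (y : nat -> bool) (n : nat) (t : seq bool) : Prop :=
  forall i, (i < size t)%N -> y (n + i)%N = nth false t i.

Definition cylinder (u : seq bool) : set (nat -> bool) :=
  [set y | matches y 0 u].

(* Talagrand's combinatorial form of meagerness in the Cantor space: the sets of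
   sequences that match [T n] at position [n] for only finitely many [n] are
   cofinal among the meager sets. *)
Definition meager (M : set (nat -> bool)) : Prop :=
  exists T : nat -> seq bool, forall y, M y ->
    exists N, forall n, (N <= n)%N -> ~ matches y n (T n).

Lemma matches_cat (y : nat -> bool) (n : nat) (s t : seq bool) :
  matches y n (s ++ t) <-> matches y n s /\ matches y (n + size s) t.
Proof.
split=> [m|[ms mt] i].
  split=> i lti.
    by rewrite m ?size_cat ?nth_cat ?lti // ltn_addr.
  rewrite -addnA m ?size_cat ?ltn_add2l // nth_cat ltnNge leq_addr /=.
  by rewrite addKn.
rewrite size_cat nth_cat; case: (ltnP i (size s)) => [lti _|les lti].
  exact: ms.
by rewrite -mt; [congr y; lia|lia].
Qed.

Lemma matches_mkseq (x y : nat -> bool) (n : nat) :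
  matches x 0 (mkseq y n) <-> forall i, (i < n)%N -> x i = y i.
Proof.
by rewrite /matches size_mkseq; split=> xy i lti; have := xy i lti;
  rewrite nth_mkseq.
Qed.

Lemma matches_self (y : nat -> bool) (n : nat) : matches y 0 (mkseq y n).
Proof. exact/matches_mkseq. Qed.

Lemma mkseq_addn (T : Type) (y : nat -> T) (m n : nat) :
  mkseq y (m + n) = mkseq y m ++ mkseq (fun i => y (m + i)%N) n.
Proof. by rewrite /mkseq iotaD map_cat add0n -{2}[m]addn0 iotaDl -map_comp. Qed.

Lemma matches_mkseq_cat (y : nat -> bool) (n : nat) (t : seq bool) :
  matches y n t -> mkseq y (n + size t) = mkseq y n ++ t.
Proof.
move=> m; rewrite mkseq_addn; congr cat.
apply: (@eq_from_nth _ false); rewrite size_mkseq // => i lti.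
by rewrite nth_mkseq ?m.
Qed.

Lemma meagerS (M N : set (nat -> bool)) : M `<=` N -> meager N -> meager M.
Proof. by move=> MN [T TP]; exists T => y /MN/TP. Qed.

Lemma meager0 : meager set0.
Proof. by exists (fun=> [::]). Qed.

(** Diagonal concatenation: [pat n n] strings together, for each [j < n], the pattern of [M j] for
    the position it will occupy, so a match at [n] gives one for [M j] at or beyond [n]. *)
Lemma meager_bigcup (M : nat -> set (nat -> bool)) :
  (forall k, meager (M k)) -> meager (\bigcup_k M k).
Proof.
move=> /choice[T TP].
pose pat n := fix pat k := if k is j.+1
  then pat j ++ T j (n + size (pat j))%N else [::].
have patP y n j k : (j < k)%N -> matches y n (pat n k) ->
    exists2 n', (n <= n')%N & matches y n' (T j n').
  elim: k => // k IH; rewrite ltnS leq_eqVlt => /predU1P[->|ltjk] /=.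
    move=> /matches_cat[_ ?]; exists (n + size (pat n k))%N => //.
    exact: leq_addr.
  by move=> /matches_cat[/(IH ltjk)].
exists (fun n => pat n n) => y [j _ /TP[N yN]].
exists (maxn N j.+1) => n; rewrite geq_max => /andP[Nn jn].
move=> /(patP _ _ _ _ jn)[n' nn'].
by apply: yN; exact: leq_trans nn'.
Qed.

Lemma meager_bigcup_countable (C : countType) (M : C -> set (nat -> bool)) :
  (forall c, meager (M c)) -> meager (\bigcup_c M c).
Proof.
move=> mM; pose M' k := if unpickle k is Some c then M c else set0.
apply: (@meagerS _ (\bigcup_k M' k)).
  by move=> y [c _ My]; exists (pickle c); rewrite // /M' pickleK.
apply: meager_bigcup => k; rewrite /M'.
by case: unpickle => [c|]; [exact: mM|exact: meager0].
Qed.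

Lemma meagerU (M N : set (nat -> bool)) :
  meager M -> meager N -> meager (M `|` N).
Proof.
move=> mM mN; rewrite -bigcup2E; apply: meager_bigcup => -[|[|k]] //=.
exact: meager0.
Qed.

(** The finitely many words of length [n] are served in turn; [Dmono] preserves those already
    served. *)
Lemma uniform_extension (D : seq bool -> Prop) (n : nat) :
  (forall u t, D u -> D (u ++ t)) -> (forall u, exists t, D (u ++ t)) ->
  exists t, forall u, size u = n -> D (u ++ t).
Proof.
move=> Dmono Ddense.
have [t tP] : exists t, forall u,
    u \in map val (enum {: n.-tuple bool}) -> D (u ++ t).
  elim: (map _ _) => [|u L [t tP]]; first by exists [::].
  have [t' Dt'] := Ddense (u ++ t); exists (t ++ t') => v; rewrite catA inE.
  by move=> /predU1P[->//|/tP]; exact: Dmono.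
exists t => u /eqP szu; apply: tP; apply/mapP.
by exists (Tuple szu) => //; rewrite mem_enum.
Qed.

(** The pattern at [n] must lead into the dense open set given by [D] whatever the first [n] bits
    are, hence [uniform_extension]. *)
Lemma meager_nowhere_dense (D : seq bool -> Prop) :
  (forall u t, D u -> D (u ++ t)) -> (forall u, exists t, D (u ++ t)) ->
  meager [set y | forall m, ~ D (mkseq y m)].
Proof.
move=> Dmono Ddense.
have /choice[T TP] := fun n => @uniform_extension D n Dmono Ddense.
exists T => y /= nD; exists 0%N => n _ /matches_mkseq_cat e.
by apply: (nD (n + size (T n))%N); rewrite e; apply: TP; rewrite size_mkseq.
Qed.

(* Otherwise [Q] is meager in densely many cylinders; it is the union of its
   parts in these countably many cylinders and a nowhere dense set. *)
Lemma nonmeager_localize (Q : set (nat -> bool)) (u : seq bool) :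
  ~ meager (Q `&` cylinder u) ->
  exists t, forall t', ~ meager (Q `&` cylinder (u ++ t ++ t')).
Proof.
move=> nm; apply: contrapT => /forallNP nt; apply: nm.
set Qu := _ `&` _; pose W w := meager (Qu `&` cylinder w).
have Wmono w t : W w -> W (w ++ t).
  by apply: meagerS => y [Qy /matches_cat[]].
have Wdense w : exists t, W (w ++ t).
  (* Padding makes [w'] at least as long as [u], so either [w'] extends [u] or [Qu] misses its
     cylinder. *)
  pose w' := w ++ nseq (size u) false.
  have [[y [[Qy uy] /= yw']]|no] := pselect (Qu `&` cylinder w' !=set0).
    have [t ew'] : exists t, w' = u ++ t.
      exists (drop (size u) w'); rewrite -{1}(cat_take_drop (size u) w').
      congr cat; apply: (@eq_from_nth _ false).
        by rewrite size_takel // size_cat size_nseq leq_addl.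
      move=> i; rewrite size_takel ?size_cat ?size_nseq ?leq_addl // => lti.
      rewrite nth_take // -uy // -yw' // size_cat size_nseq.
      exact: ltn_addl.
    have /existsNP[t' /contrapT mt'] := nt t.
    exists (nseq (size u) false ++ t'); rewrite catA -/w' ew' -catA.
    by apply: (meagerS _ mt') => x [[]].
  exists (nseq (size u) false); rewrite -/w'; apply: meagerS meager0 => y Hy.
  by apply: no; exists y.
apply: (@meagerS _ ((\bigcup_w [set y | W w /\ (Qu `&` cylinder w) y])
   `|` [set y | forall m, ~ W (mkseq y m)])).
  move=> y Qy; have [[m Wm]|no] := pselect (exists m, W (mkseq y m)); last first.
    by right=> m Wm; apply: no; exists m.
  left; exists (mkseq y m) => //; split=> //; split=> //.
  exact: matches_self.
apply: meagerU; last exact: meager_nowhere_dense.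
apply: meager_bigcup_countable => w; have [Ww|nW] := pselect (W w).
  by apply: meagerS Ww => y [].
by apply: meagerS meager0 => y [/nW].
Qed.

(** * Category of Suslin sets *)

(** [P s] stands for the points with a witness extending [s]; [Pclosed] is the form in which
    continuity of the witnessing map enters. *)
Lemma comeager_suslin (P : seq nat -> set (nat -> bool)) :
  (forall s y, P s y -> exists n, P (rcons s n) y) ->
  (forall z x, (forall k, exists2 y, P (mkseq z k) y & cylinder (mkseq x k) y) ->
    P [::] x) ->
  (forall u, ~ meager (P [::] `&` cylinder u)) ->
  meager (~` P [::]).
Proof.
move=> Psplit Pclosed Pnm.
(* Off the meager sets [N s] below, any point can be followed down a branch [z]
   along which [P (mkseq z k)] stays nonmeager near it, hence lies in [P [::]]. *)
pose good s u := forall t, ~ meager (P s `&` cylinder (u ++ t)).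
have good_cat s u t : good s u -> good s (u ++ t).
  by move=> g t'; rewrite -catA.
have good_split s u : good s u -> exists n t, good (rcons s n) (u ++ t).
  move=> /(_ [::]); rewrite cats0 => nm.
  have [n nmn] : exists n, ~ meager (P (rcons s n) `&` cylinder u).
    apply: contrapT => /forallNP mn; apply: nm.
    apply: (@meagerS _ (\bigcup_n (P (rcons s n) `&` cylinder u))).
      by move=> y [/Psplit[n Pn] yu]; exists n.
    by apply: meager_bigcup => n; apply: contrapT; exact: mn.
  have [t tP] := nonmeager_localize nmn; exists n, t => t'.
  by rewrite -catA.
pose N s := [set y | (exists m, good s (mkseq y m)) /\
                     forall n m, ~ good (rcons s n) (mkseq y m)].
have mN s : meager (N s).
  (* The second disjunct makes [D] dense; prefixes of points of [N s] never satisfy it, since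
     lengthening a good prefix keeps it good. *)
  pose D u := (exists n, good (rcons s n) u) \/ forall t, ~ good s (u ++ t).
  apply: (@meagerS _ [set y | forall m, ~ D (mkseq y m)]).
    move=> y [[m gm] ngood] k [[n /ngood//]|].
    move=> /(_ (mkseq (fun i => y (k + i)%N) m)); rewrite -mkseq_addn.
    by rewrite addnC mkseq_addn; apply; exact: good_cat.
  apply: meager_nowhere_dense => [u t [[n gn]|ng]|u].
  - by left; exists n; exact: good_cat.
  - by right=> t'; rewrite -catA.
  - have [[t gt]|ng] := pselect (exists t, good s (u ++ t)).
      have [n [t' gt']] := good_split _ _ gt.
      by exists (t ++ t'); left; exists n; rewrite catA.
    exists [::]; right=> t; rewrite cats0 => gt; apply: ng; by exists t.
apply: (@meagerS _ (\bigcup_s N s)); last exact: meager_bigcup_countable.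
move=> y nPy; apply: contrapT => nN; apply: nPy.
have /choice[nxt nxtP] : forall s, exists n, (exists m, good s (mkseq y m)) ->
    exists m, good (rcons s n) (mkseq y m).
  move=> s; apply: contrapT => /forallNP no; apply: nN; exists s => //; split.
    by apply: contrapT => ns; apply: (no 0%N).
  by move=> n m g; apply: (no n) => _; exists m.
pose branch k := iter k (fun s => rcons s (nxt s)) [::].
pose z k := nxt (branch k).
have branchE k : branch k = mkseq z k.
  by elim: k => // k IH; rewrite mkseqS -IH.
have goodz k : exists m, good (mkseq z k) (mkseq y m).
  elim: k => [|k IH]; first by exists 0%N => t; exact: Pnm.
  by rewrite mkseqS -branchE; apply: nxtP; rewrite branchE.
apply: (Pclosed z) => k; have [m gm] := goodz k.
(* As [m] may be less than [k], [k] more bits are taken to ensure agreement with [y] up to [k]. *)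
have := gm (mkseq (fun i => y (m + i)%N) k); rewrite -mkseq_addn => nm.
have [x [Px xy]] : P (mkseq z k) `&` cylinder (mkseq y (m + k)) !=set0.
  apply: contrapT => no; apply: nm; apply: meagerS meager0 => x Hx.
  by apply: no; exists x.
exists x => //; move: xy => /=; rewrite addnC mkseq_addn => /matches_cat[].
by [].
Qed.

(** * Coanalytic ideals and meagerness *)

Lemma continuous_baire_cantor (f : baire_space -> cantor_space)
    (z : nat -> nat) (zs : nat -> nat -> nat) (i : nat) :
  continuous f -> (forall k j, (j < k)%N -> zs k j = z j) ->
  exists N, forall k, (N <= k)%N -> f (zs k) i = f z i.
Proof.
move=> cf zsz.
have cz : (zs : nat -> baire_space) k @[k --> \oo] --> (z : baire_space).
  apply/cvg_sup => j; apply/cvg_image.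
    by rewrite eqEsubset; split=> // n _; exists (fun=> n).
  move=> U /= /principal_filterP Uz.
  exists [set y | U (y j)].
    by exists j.+1 => // k /= jk; rewrite zsz.
  by rewrite eqEsubset; split=> [_ [y Uy <-]|n Un] //; exists (fun=> n).
have : f (zs k) i @[k --> \oo] --> f z i.
  apply: (@cvg_comp _ _ _ (fun k => f (zs k)) (@proj _ (fun=> bool) i)
    _ (nbhs (f z))).
    by apply: cvg_comp cz _; exact: cf.
  exact: (@proj_continuous _ (fun=> bool) i (f z)).
move=> /(_ [set f z i]) /=.
move=> /(_ (discrete_set1 _)) [N _ NP].
by exists N.
Qed.

Lemma suslin_ideal_meager (P : seq nat -> set (nat -> bool)) :
  (forall s y, P s y -> exists n, P (rcons s n) y) ->
  (forall z x, (forall k, exists2 y, P (mkseq z k) y & cylinder (mkseq x k) y) ->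
    P [::] x) ->
  (forall N x y, (forall n, (N <= n)%N -> x n = y n) -> P [::] x -> P [::] y) ->
  (forall y, ~ P [::] y -> P [::] (fun n => ~~ y n)) ->
  meager (~` P [::]).
Proof.
move=> Psplit Pclosed Ptail Pneg.
have [[u [T TP]]|nm] := pselect (exists u, meager (P [::] `&` cylinder u));
  last by apply: comeager_suslin => // u mu; apply: nm; exists u.
exists (fun n => map negb (T n)) => y /Pneg Py.
(* The complement of [y], moved into the cylinder of [u] by changing finitely many bits, stays in [P
   [::]]. So it eventually avoids [T], and [y] avoids the negated patterns. *)
pose x n := if (n < size u)%N then nth false u n else ~~ y n.
have xy n : (size u <= n)%N -> x n = ~~ y n by rewrite /x ltnNge => ->.
have [|N NP] := TP x.
  split; first by apply: Ptail Py => n /xy.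
  by move=> i iu; rewrite add0n /x iu.
exists (maxn N (size u)) => n; rewrite geq_max => /andP[Nn un] my.
apply: (NP n Nn) => i iT; rewrite xy ?(leq_trans un) ?leq_addr //.
by rewrite my ?size_map // (nth_map false) ?negbK.
Qed.

(** With [l n] the length of the pattern [T n], a member of [J] filling infinitely many intervals
    could be thinned out, within [J], to match infinitely many patterns. *)
Lemma meager_hereditary_intervals (J : set (nat -> bool)) :
  (forall x y : nat -> bool, (forall i, x i -> y i) -> J y -> J x) -> meager J ->
  exists l : nat -> nat, forall y : nat -> bool,
    (forall N, exists2 n, (N <= n)%N & forall i, (n <= i < n + l n)%N -> y i) ->
    ~ J y.
Proof.
move=> Jdown [T TP]; exists (fun n => size (T n)) => y yfull Jy.
have /choice[nxt nxtP] : forall N, exists n, (N <= n)%N /\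
    forall i, (n <= i < n + size (T n))%N -> y i.
  by move=> N; have [n ? ?] := yfull N; exists n.
(* The chosen intervals are kept disjoint: the patterns [T n] of overlapping
   intervals may conflict. *)
pose a := fix a k := if k is j.+1 then nxt (a j + size (T (a j))).+1 else nxt 0%N.
have aS k : (a k + size (T (a k)) < a k.+1)%N.
  by case: (nxtP (a k + size (T (a k))).+1).
have alt j k : (j < k)%N -> (a j + size (T (a j)) < a k)%N.
  elim: k => // k IH; rewrite ltnS leq_eqVlt => /predU1P[->//|/IH jk].
  by have := aS k; lia.
have age k : (k <= a k)%N.
  by elim: k => // k IH; have := aS k; lia.
have afull k i : (a k <= i < a k + size (T (a k)))%N -> y i.
  case: k => [|k]; first by case: (nxtP 0%N) => _; apply.
  by case: (nxtP (a k + size (T (a k))).+1) => _; apply.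
pose x i := `[< exists2 k, (a k <= i < a k + size (T (a k)))%N &
                           nth false (T (a k)) (i - a k) >].
have Jx : J x by apply: Jdown Jy => i /asboolP[k /afull].
have [N NP] := TP x Jx; apply: (NP (a N) (age N)) => i iT.
apply/asboolP/idP => [[k ik]|iN]; last first.
  by exists N; rewrite ?addKn // leq_addr ltn_add2l.
have -> : k = N; last by rewrite addKn.
case: (ltngtP k N) => [/alt|/alt|//]; move: ik; lia.
Qed.

(** The ideal is pulled back along the continuous map [pull]. Finite fibres turn finite changes of
    [y] into finite changes of a subset of [B]; as [B] is not in [I], a sequence and its complement
    are never both sent into [I]. *)
Lemma coanalytic_ideal_meager (I : set (set nat)) (B : set nat)
    (idx : nat -> nat) :
  ideal I -> coanalytic (cantor_family I) -> ~ I B ->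
  (forall j, finite_set (B `&` idx @^-1` [set j])) ->
  meager [set y : nat -> bool | I (B `&` [set i | y (idx i)])].
Proof.
move=> [IU IS Ifin IT] coI nIB finB.
pose pull (x : nat -> bool) : cantor_space := fun i => `[< B i >] && x (idx i).
have pullE x : [set i | pull x i] = B `&` [set i | x (idx i)].
  apply/seteqP; split=> i /=; first by move=> /andP[/asboolP].
  by move=> [Bi xi]; apply/andP; split=> //; exact/asboolP.
case: coI => [coI|[f cf rf]].
  have : (~` cantor_family I) (fun=> true).
    by rewrite /= /cantor_family /=; apply: contra_not IT; apply: IS.
  by rewrite coI.
pose P s := [set x | exists2 z : baire_space, mkseq z (size s) = s & f z = pull x].
have PE x : P [::] x <-> ~ I (B `&` [set i | x (idx i)]).
  rewrite -pullE -[~ _]/((~` cantor_family I) (pull x)) rf.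
  by split=> [[z _ e]|[z _ e]]; exists z.
have -> : [set y : nat -> bool | I (B `&` [set i | y (idx i)])] = ~` P [::].
  apply/seteqP; split=> y /=; rewrite PE; first by move=> Iy /(_ Iy).
  exact: contrapT.
apply: suslin_ideal_meager.
- move=> s x [z zs fz]; exists (z (size s)); exists z => //.
  by rewrite size_rcons mkseqS zs.
- move=> z x zx.
  have /choice[p pP] : forall k, exists p : baire_space * (nat -> bool),
      [/\ forall j, (j < k)%N -> p.1 j = z j, f p.1 = pull p.2
        & forall j, (j < k)%N -> p.2 j = x j].
    move=> k; have [y [w]] := zx k; rewrite size_mkseq => wz fw yx.
    exists (w, y); split=> //=; last exact/matches_mkseq.
    by move=> j jk; rewrite -(nth_mkseq 0%N w jk) wz nth_mkseq.
  exists z => //; apply: funext => i.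
  have [k j jk|N NP] := @continuous_baire_cantor f z (fun k => (p k).1) i cf.
    by case: (pP k) => + _ _; apply.
  (* At this index the [i]-th coordinate of the image has stabilized, and the approximating point
     agrees with [x] at [idx i]. *)
  have [_ fp px] := pP (maxn N (idx i).+1).
  by rewrite -(NP _ (leq_maxl N (idx i).+1)) fp /pull px // leq_maxr.
- move=> N x y xy; rewrite !PE; apply: contra_not => Iy.
  apply: (IS _ ((B `&` [set i | y (idx i)]) `|`
                \bigcup_(j in `I_N) (B `&` idx @^-1` [set j]))); last first.
    by apply: IU => //; apply: Ifin; exact: bigcup_finite.
  move=> i [Bi /= xi]; have [ltN|geN] := ltnP (idx i) N.
    by right; exists (idx i).
  by left; split=> //=; rewrite -xy.
- move=> y; rewrite !PE => /contrapT Iy Iny; apply: nIB.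
  apply: IS (IU _ _ Iy Iny) => i Bi.
  by case yi: (y (idx i)); [left|right]; rewrite /= ?yi.
Qed.

(** * Unbounded families and disjoint sequences *)

Lemma finite_set_ltn (A : set nat) :
  finite_set A -> exists b, forall x, A x -> (x < b)%N.
Proof.
move=> /finite_seqP[s ->]; exists (\max_(x <- s) x).+1 => x /= xs.
by rewrite ltnS; exact: leq_bigmax_seq.
Qed.

Definition levels (f : nat -> nat) : nat -> set nat := seqDU (fun i => `I_(f i)).

Lemma levels_disjoint (f : nat -> nat) : disjoint_seqs Fin (levels f).
Proof.
split=> [n|]; last exact: trivIset_seqDU.
exact: sub_finite_set (@subset_seqDU _ _ n) (finite_II _).
Qed.

Lemma levels_cover (f : nat -> nat) (i n x : nat) : (i <= n)%N -> (x < f i)%N ->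
  (\bigcup_(j in [set j | (j <= n)%N]) levels f j) x.
Proof.
move=> lein ltx; have : (\bigcup_(j < n.+1) `I_(f j)) x by exists i.
by rewrite bigcup_mkord (bigsetU_seqDU (fun i => `I_(f i))) -bigcup_mkord.
Qed.

Lemma levels_ge (f : nat -> nat) (n x : nat) : levels f n.+1 x -> (f n <= x)%N.
Proof.
move=> [_ nx]; rewrite leqNgt; apply/negP => ltx; apply: nx.
by rewrite -(bigcup_mkord n.+1 (fun i => `I_(f i))); exists n => /=.
Qed.

Lemma unbounded_levels (I : set (set nat)) (F : set (nat -> nat)) :
  ideal I -> coanalytic (cantor_family I) -> weak_P_ideal I ->
  unbounded_family F -> b_family I I Fin (levels @` F).
Proof.
move=> idI coI wPI uF; split=> [_ [f _ <-]|A [[IA _] AT]].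
  exact: levels_disjoint.
have [_ IS _ _] := idI.
have [||B nIB finAB] := wPI (range A).
- exact: card_image_le.
- by move=> _ [n _ <-].
have /choice[idx idxP] : forall i, exists n, A n i.
  by move=> i; have : [set: nat] i by []; rewrite -AT => -[n _]; exists n.
have mJ : meager [set y : nat -> bool | I (B `&` [set i | y (idx i)])].
  apply: coanalytic_ideal_meager => // j.
  apply: sub_finite_set (finAB (A j) (imageT _ _)) => i [Bi /= <-].
  by split=> //; exact: idxP.
have [|l lP] := meager_hereditary_intervals _ mJ.
  move=> x y xy; apply: IS => i [Bi xi]; split=> //=; exact: xy.
have /choice[g gP] := fun n => finite_set_ltn (finAB (A n) (imageT _ _)).
pose h n := (\max_(m < n + l n) g m)%N.
have [f Ff fh] : exists2 f, F f & ~ eventually_le f h.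
  apply: contrapT => no; apply: uF; exists h => f Ff.
  by apply: contrapT => nfh; apply: no; exists f.
exists (levels f); first by exists f.
(* If [h n < f n], the levels up to [n] already cover [A m] on [B] for all [m < n + l n], so [y] is
   full on [[n, n + l n)]. *)
pose y m := `[< A m `&` B `<=` \bigcup_(i in [set i | (i <= m)%N]) levels f i >].
apply: contra_not (lP y _) => [II|N] /=.
  apply: IS II => i [Bi /asboolP yi]; exists (idx i) => //.
  by split; [exact: idxP|apply: yi; split=> //; exact: idxP].
apply: contrapT => no; apply: fh; exists N => // n /= Nn.
rewrite leqNgt; apply/negP => hf; apply: no; exists n => // m /andP[nm ml].
apply/asboolP => x /gP xg; apply: (levels_cover nm).
apply: leq_trans hf; rewrite ltnS; apply: leq_trans (ltnW xg) _.
exact: (leq_bigmax (Ordinal ml)).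
Qed.

Lemma b_family_unbounded (I : set (set nat)) (E : set (nat -> set nat)) :
  ideal I -> b_family I Fin Fin E ->
  exists r : (nat -> set nat) -> nat -> nat, unbounded_family (r @` E).
Proof.
move=> [_ IS Ifin _] [EFin EP].
have /choice[r rP] : forall e : nat -> set nat, exists f : nat -> nat,
    disjoint_seqs Fin e -> forall n i x, (i <= n)%N -> e i x -> (x < f n)%N.
  move=> e; have [[fe _]|ne] := pselect (disjoint_seqs Fin e); last first.
    by exists id.
  have /choice[g gP] := fun i => finite_set_ltn (fe i).
  exists (fun n => \max_(i < n.+1) g i)%N => _ n i x lein /gP xg.
  by apply: leq_trans xg _; exact: (leq_bigmax (Ordinal (lein : (i < n.+1)%N))).
(* Block [n.+1] of [levels h] starts no earlier than [h n], hence the shift in [g n.+1]; the summand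
   [n] makes the blocks cover omega. *)
exists r => -[g gP]; pose h n := (n + g n.+1)%N.
have [|e Ee] := EP (levels h).
  split; first exact: levels_disjoint.
  rewrite -seqDU_bigcup_eq -subTset => x _; exists x.+1 => //=.
  by rewrite /h addSn ltnS leq_addr.
apply; have [N _ NP] := gP (r e) (imageP _ Ee).
apply: Ifin; apply: sub_finite_set (finite_II (\max_(n < N.+1) h n)).
move=> x [n _ [hx [i /= lein ex]]].
have xr := rP e (EFin _ Ee) n i x lein ex.
have [ltnN|leNn] := ltnP n N.+1.
  apply: leq_trans (leq_bigmax (Ordinal ltnN)).
  by have := @subset_seqDU _ _ n _ hx.
case: n leNn hx {lein} xr => // n leNn /levels_ge hx xr.
have /= := NP n.+1 (ltnW leNn); move: hx xr; rewrite /h; lia.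
Qed.

(** Diagonalization: [C n] holds the terms up to [n] of the first [n] sequences, so block [A n]
    misses the terms up to [n] of sequence [k] once [k < n]. Only the blocks up to [k] remain, and
    their union is in [I]. *)
Lemma b_family_uncountable (I : set (set nat)) (E : set (nat -> set nat)) :
  ideal I -> b_family I I I E -> ~ countable E.
Proof.
move=> [IU IS Ifin _] [EI EP] /countable_injP[c cinj].
have Ibig n (D : nat -> set nat) : (forall k, I (D k)) -> I (\bigcup_(k < n) D k).
  move=> ID; elim: n => [|n IH].
    by rewrite bigcup_mkord big_ord0; exact: Ifin.
  by rewrite bigcup_mkord big_ord_recr -bigcup_mkord; exact: IU.
have /choice[e eP] : forall k, exists e : nat -> set nat, (forall i, I (e i)) /\
    (forall e', E e' -> c e' = k -> e' = e).
  move=> k; have [[e Ee ek]|no] := pselect (exists2 e, E e & c e = k).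
    exists e; split=> [|e' Ee' e'k]; first by case: (EI _ Ee).
    by apply: cinj; rewrite ?inE // e'k.
  exists (fun=> set0); split=> [i|e' Ee' e'k]; first exact: Ifin.
  by case: no; exists e'.
pose C n := `I_n `|` \bigcup_(k < n) \bigcup_(i < n.+1) e k i.
have IC n : I (C n).
  apply: IU; first exact/Ifin/finite_II.
  by apply: (Ibig) => k; apply: (Ibig) => i; case: (eP k).
pose A := seqDU (fun n => C n.+1).
have IA n : I (A n) by apply: IS (IC n.+1); exact: subset_seqDU.
have [|e' Ee'] := EP A.
  split; first by split=> //; exact: trivIset_seqDU.
  by rewrite -seqDU_bigcup_eq -subTset => x _; exists x => //; left => /=.
apply; apply: IS (Ibig (c e').+1 A IA) => x [n _ [Ax [i /= lein ex]]].
exists n => //=; rewrite ltnS leqNgt; apply/negP => ltcn.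
case: n ltcn Ax lein => // n ltcn [_ nCx] lein; apply: nCx.
rewrite -(bigcup_mkord n.+1 (fun i => C i.+1)); exists n => //=; right.
exists (c e') => //; exists i => //.
by case: (eP (c e')) => _ /(_ _ Ee' erefl) <-.
Qed.

(** * Comparison of the cardinals *)

Lemma lec_trans (a b c : cardinal) : lec a b -> lec b c -> lec a c.
Proof.
have [A ->] := cardinal_surj a; have [B ->] := cardinal_surj b.
by have [C ->] := cardinal_surj c; rewrite !lecE; exact: card_le_trans.
Qed.

Lemma lec_antisym (a b : cardinal) : lec a b -> lec b a -> a = b.
Proof.
have [A ->] := cardinal_surj a; have [B ->] := cardinal_surj b.
by rewrite !lecE => AB BA; apply/cardinal_ofE/card_eqPle.
Qed.

(** For empty [S] the right-hand side would be the default [d], which need not bound anything. *)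
Lemma lec_minc (d : cardinal) (S S' : cardinal -> Prop) : (exists c, S c) ->
  (forall c, S c -> exists2 c', S' c' & lec c' c) -> lec (minc d S') (minc d S).
Proof.
move=> /(minc_in d) Sm /(_ _ Sm)[c' S'c']; apply: lec_trans.
exact: minc_le.
Qed.

Lemma aleph1_le (T : Type) (A : set T) :
  ~ countable A -> lec aleph1 (cardinal_of A).
Proof.
move=> nA; apply: minc_le; split.
  by case: (lec_total aleph0 (cardinal_of A)) => // /lecE.
by move=> /cardinal_ofE /card_eqPle[_].
Qed.

Lemma b_family_mono (I J J' K K' : set (set nat)) (E : set (nat -> set nat)) :
  J' `<=` J -> K `<=` K' -> b_family I J K E -> b_family I J' K' E.
Proof.
move=> J'J KK' [EK EP]; split=> [e /EK[Ke dise]|A [[J'A disA] AT]].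
  by split=> // n; exact: KK'.
by apply: EP; split=> //; split=> // n; exact: J'J.
Qed.

Lemma unbounded_setT : unbounded_family setT.
Proof.
move=> [g /(_ (fun n => (g n).+1) Logic.I)[N _ /(_ N)]] /=.
by rewrite ltnn leqnn => /(_ isT).
Qed.

Theorem theorem6p8 (I : set (set nat)) (idealI : ideal I)
    (coanalyticI : coanalytic (cantor_family I)) (weakPI : weak_P_ideal I) :
  lec aleph1 (b_cardinal I I I) /\
  lec (b_cardinal I I I) bounding_number /\
  bounding_number = b_cardinal I Fin Fin /\
  b_cardinal I Fin Fin = b_cardinal I I Fin.
Proof.
have FinI : Fin `<=` I by case: idealI.
(* The minima are over nonempty classes, so their default value never intervenes. *)
have exIIFin : exists c, exists2 E, b_family I I Fin E & c = cardinal_of E.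
  exists (cardinal_of (levels @` setT)); exists (levels @` setT) => //.
  exact: unbounded_levels unbounded_setT.
have exIFinFin : exists c, exists2 E, b_family I Fin Fin E & c = cardinal_of E.
  by have [c [E bE cE]] := exIIFin; exists c, E => //; exact: b_family_mono bE.
have exIII : exists c, exists2 E, b_family I I I E & c = cardinal_of E.
  by have [c [E bE cE]] := exIIFin; exists c, E => //; exact: b_family_mono bE.
have IIFin_b : lec (b_cardinal I I Fin) bounding_number.
  apply: lec_minc.
    exists (cardinal_of [set: nat -> nat]), setT => //; exact: unbounded_setT.
  move=> _ [F uF ->]; exists (cardinal_of (levels @` F)); last first.
    by apply/lecE; exact: card_image_le.
  by exists (levels @` F) => //; exact: unbounded_levels.
have b_IFinFin : lec bounding_number (b_cardinal I Fin Fin).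
  apply: lec_minc => // _ [E bE ->].
  have [r ur] := b_family_unbounded idealI bE.
  exists (cardinal_of (r @` E)); first by exists (r @` E).
  by apply/lecE; exact: card_image_le.
have IFinFin_IIFin : lec (b_cardinal I Fin Fin) (b_cardinal I I Fin).
  apply: lec_minc => // _ [E bE ->]; exists (cardinal_of E).
    by exists E => //; exact: b_family_mono bE.
  exact/lecE.
have III_IIFin : lec (b_cardinal I I I) (b_cardinal I I Fin).
  apply: lec_minc => // _ [E bE ->]; exists (cardinal_of E).
    by exists E => //; exact: b_family_mono bE.
  exact/lecE.
split; last split; last split.
- have [E bE] := minc_in (succc continuum) exIII; rewrite /b_cardinal => ->.
  exact/aleph1_le/(b_family_uncountable idealI).
- exact: lec_trans III_IIFin IIFin_b.
- by apply: lec_antisym => //; exact: lec_trans IIFin_b.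
- by apply: lec_antisym => //; exact: lec_trans b_IFinFin.
Qed.
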